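(* Let $x=(x_1,x_2,\ldots,x_n)\in S_{\ell_1^n}$. Then $x$ is $\rho$-right symmetric if and only if at least one of the following conditions holds: (i) $x\in Ext(B_{\ell_1^n})$; (ii) for any two nonempty disjoint sets $A,B\subset\mathcal{Z}_x^c$, $\left|\sum_{j\in A}x_j\right|\ne\left|\sum_{j\in B}x_j\right|$.
   Context: $\ell_1^n$ is $\mathbb{R}^n$ with the norm $\|x\|=\sum_{i=1}^n|x_i|$; $B_\mathbb{X}$ and $S_\mathbb{X}$ are the closed unit ball and unit sphere of a normed space $\mathbb{X}$, and $Ext(C)$ is the set of extreme points of a convex set $C$. For $x\in\mathbb{R}^n$, $\mathcal{Z}_x=\{i\in\{1,\ldots,n\}:x_i=0\}$ and $\mathcal{Z}_x^c=\{1,\ldots,n\}\setminus\mathcal{Z}_x$. Norm derivatives: $\rho'_{\pm}(x,y)=\|x\|\lim_{t\to 0^{\pm}}\frac{\|x+ty\|-\|x\|}{t}$ and $\rho'(x,y)=\frac12(\rho'_+(x,y)+\rho'_-(x,y))$. $\rho$-orthogonality: $x\perp_\rho y$ means $\rho'(x,y)=0$. An element $x\in\mathbb{X}$ is $\rho$-right symmetric if $y\perp_\rho x$ implies $x\perp_\rho y$ for all $y\in\mathbb{X}$. *)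

(* Defs.v *)
From HB Require Import structures.
From mathcomp Require Import all_boot all_order all_algebra.
From mathcomp Require Import all_classical all_reals all_analysis.

Set Implicit Arguments.
Unset Strict Implicit.
Unset Printing Implicit Defensive.

Import Order.TTheory GRing.Theory Num.Theory.
Import numFieldNormedType.Exports.

Local Open Scope classical_set_scope.
Local Open Scope ring_scope.

Section NormedSpace.
Context {R : realType} {V : normedModType R}.
Implicit Types (x y : V) (C : set V).

Definition unit_ball : set V := [set x | `|x| <= 1].
Definition unit_sphere : set V := [set x | `|x| = 1].

Definition extreme_points C : set V :=
  [set x | C x /\ forall y z (t : R), C y -> C z -> 0 < t < 1 ->
             x = t *: y + (1 - t) *: z -> y = x /\ z = x].

(* By convexity of the norm the two one-sided limits below always exist, so
   the default value of [lim] on divergent filters never occurs. *)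
Definition rho_right x y : R :=
  `|x| * lim ((`|x + t *: y| - `|x|) / t @[t --> (0 : R)^'+]).
Definition rho_left x y : R :=
  `|x| * lim ((`|x + t *: y| - `|x|) / t @[t --> (0 : R)^'-]).
Definition rho x y : R := 2^-1 * (rho_right x y + rho_left x y).

Definition rho_orthogonal x y : Prop := rho x y = 0.

Definition rho_right_symmetric x : Prop :=
  forall y, rho_orthogonal y x -> rho_orthogonal x y.

End NormedSpace.

Arguments unit_ball {R} V.
Arguments unit_sphere {R} V.

(* An alias of ['rV[R]_n] is needed because the canonical norm of the latter in
   MathComp-Analysis is the sup norm. *)
Definition l1 (R : realType) (n : nat) : Type := 'rV[R]_n.

Section L1.
Variables (R : realType) (n : nat).

HB.instance Definition _ := GRing.Lmodule.copy (l1 R n) 'rV[R]_n.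

Definition l1_norm (x : l1 R n) : R := \sum_(i < n) `|x 0 i|.

Lemma l1_normD (x y : l1 R n) : l1_norm (x + y) <= l1_norm x + l1_norm y.
Proof.
by rewrite /l1_norm -big_split; apply: ler_sum => i _; rewrite mxE ler_normD.
Qed.

Lemma l1_normZ (a : R) (x : l1 R n) : l1_norm (a *: x) = `|a| * l1_norm x.
Proof.
by rewrite /l1_norm mulr_sumr; apply: eq_bigr => i _; rewrite mxE normrM.
Qed.

Lemma l1_norm0_eq0 (x : l1 R n) : l1_norm x = 0 -> x = 0.
Proof.
move=> /eqP; rewrite psumr_eq0 => [/allP x0|//].
apply/rowP => i; rewrite mxE; apply/eqP; rewrite -normr_eq0.
by apply: x0; rewrite mem_index_enum.
Qed.

HB.instance Definition _ :=
  Lmodule_isNormed.Build R (l1 R n) l1_normD l1_normZ l1_norm0_eq0.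

Lemma l1_normE (x : l1 R n) : `|x| = \sum_(i < n) `|x 0 i|.
Proof. by []. Qed.

Definition zero_coords (x : l1 R n) : {set 'I_n} := [set i | x 0 i == 0]%SET.

End L1.

(* Main.v *)
(** In [l1 R n] one has [rho x y = |x| * \sum_i sg (x_i) y_i], the one-sided
    contributions [± |y_i|] of the zero coordinates of [x] cancelling. Hence
    [x] is right symmetric iff [\sum_i sg (y_i) x_i = 0] forces
    [\sum_i sg (x_i) y_i = 0]. The first condition only sees the signs of [y]
    and says that the positive and negative parts of the support of [y] carry
    equal sums of [x], whereas the second one depends on the magnitudes, which
    can be perturbed freely; this gives the equivalence with (ii), where a
    vanishing sum over a single nonempty set is excluded by splitting that set
    into two parts with opposite sums. Finally (i) is a special case of (ii): an
    [x] with two nonzero coordinates is a proper convex combination of [± e_i]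
    and its normalized remaining part, so it is not extreme. *)
Require Import Defs.
From mathcomp Require Import all_boot all_order all_algebra.
From mathcomp Require Import all_classical all_reals all_analysis.
From mathcomp Require Import ring lra.
Import Order.TTheory GRing.Theory Num.Theory.
Import numFieldNormedType.Exports.
Set Implicit Arguments.
Unset Strict Implicit.
Unset Printing Implicit Defensive.
Local Open Scope ring_scope.

Section NormDerivative.
Local Open Scope classical_set_scope.
Variables (R : realType) (n : nat).
Implicit Types (a b t : R) (x y : l1 R n).

(** While [|t * b| < |a|], the point [a + t * b] keeps the sign of [a], so the absolute value is
    linear there and the quotient is exact, not just a limit. At [a = 0] it is [Num.sg t * |b|]. *)
Lemma normr_quotient a b t : t != 0 -> `|t * b| < `|a| \/ a = 0 ->
  (`|a + t * b| - `|a|) / t = Num.sg a * b + Num.sg t * (a == 0)%:R * `|b|.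
Proof.
move=> t0 [tba|->]; last first.
  rewrite sgr0 eqxx mul0r !add0r normr0 subr0 normrM mulr1 mulrAC.
  by rewrite {1}[`|t|]normrEsg mulfK.
have a0 : a != 0 by rewrite -normr_gt0 (le_lt_trans _ tba).
rewrite (negPf a0) mulr0 mul0r addr0.
have -> : `|a + t * b| = Num.sg a * (a + t * b).
  have [a_lt0|a_gt0|a_eq0] := ltgtP a 0; last by rewrite a_eq0 eqxx in a0.
  - rewrite ltr0_sg// ltr0_norm ?mulN1r//.
    by move: tba; rewrite (ltr0_norm a_lt0) ltr_norml => /andP[]; lra.
  - rewrite gtr0_sg// gtr0_norm ?mul1r//.
    by move: tba; rewrite (gtr0_norm a_gt0) ltr_norml => /andP[]; lra.
by rewrite [`|a|]normrEsg mulrDr addrAC subrr add0r mulrCA mulrAC divff// mul1r.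
Qed.

Lemma near_normr_quotient a b : \forall t \near (0 : R)^',
  (`|a + t * b| - `|a|) / t = Num.sg a * b + Num.sg t * (a == 0)%:R * `|b|.
Proof.
have small : \forall t \near 0^', `|t * b| < `|a| \/ a = 0.
  have [->|a0] := eqVneq a 0; first by near=> t; right.
  near=> t; left; near: t; apply: nbhs_dnbhs.
  have : t * b @[t --> (0 : R)] --> 0 * b by apply: cvgMl; exact: cvg_id.
  by rewrite mul0r => /cvgr0Pnorm_lt; apply; rewrite normr_gt0.
near=> t; apply: normr_quotient; near: t; first exact: nbhs_dnbhs_neq.
exact: small.
Unshelve. all: by end_near. Qed.

Lemma near_l1_quotient x y : \forall t \near (0 : R)^',
  (`|x + t *: y| - `|x|) / t =
  \sum_i Num.sg (x 0 i) * y 0 i +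
  Num.sg t * \sum_i (x 0 i == 0)%:R * `|y 0 i|.
Proof.
have near_all := filter_forall (dnbhs_filter (0 : R))
  (fun i => near_normr_quotient (x 0 i) (y 0 i)).
apply: filterS near_all => t quotE.
rewrite !l1_normE -sumrB mulr_suml mulr_sumr -big_split /=.
by apply: eq_bigr => i _; rewrite !mxE mulrA; exact: quotE.
Qed.

(** Along a filter that fixes the sign of [t], the quotient is eventually constant; [s = 1] and
    [s = -1] give the two one-sided limits. *)
Lemma lim_l1_quotient (F : set_system R) (s : R) x y : ProperFilter F ->
  F --> (0 : R)^' -> (\forall t \near F, Num.sg t = s) ->
  lim ((`|x + t *: y| - `|x|) / t @[t --> F]) =
  \sum_i Num.sg (x 0 i) * y 0 i + s * \sum_i (x 0 i == 0)%:R * `|y 0 i|.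
Proof.
move=> FF F0 Fs; apply: cvg_lim => //; apply: cvg_near_cst.
have := F0 _ (near_l1_quotient x y); apply: filterS2 Fs => t -> ->//.
Qed.

Lemma rho_rightE x y : rho_right x y =
  `|x| * (\sum_i Num.sg (x 0 i) * y 0 i + \sum_i (x 0 i == 0)%:R * `|y 0 i|).
Proof.
rewrite /rho_right (lim_l1_quotient (s := 1)) ?mul1r//.
- by apply: within_subset => t; rewrite /= => /gt_eqF ->.
- by near=> t; rewrite gtr0_sg.
Unshelve. all: by end_near. Qed.

Lemma rho_leftE x y : rho_left x y =
  `|x| * (\sum_i Num.sg (x 0 i) * y 0 i - \sum_i (x 0 i == 0)%:R * `|y 0 i|).
Proof.
rewrite /rho_left (lim_l1_quotient (s := -1)) ?mulN1r//.
- by apply: within_subset => t; rewrite /= => /lt_eqF ->.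
- by near=> t; rewrite ltr0_sg.
Unshelve. all: by end_near. Qed.

Lemma rhoE x y : rho x y = `|x| * \sum_i Num.sg (x 0 i) * y 0 i.
Proof. by rewrite /rho rho_rightE rho_leftE; field. Qed.

Lemma rho_orthogonalP x y :
  rho_orthogonal x y <-> \sum_i Num.sg (x 0 i) * y 0 i = 0.
Proof.
rewrite /rho_orthogonal rhoE; split=> [/eqP|->]; last by rewrite mulr0.
rewrite mulf_eq0 => /orP[|/eqP//]; rewrite normr_eq0 => /eqP ->.
by rewrite big1// => i _; rewrite mxE sgr0 mul0r.
Qed.

End NormDerivative.

Lemma extreme_point_support (R : realType) (n : nat) (x : l1 R n) (i j : 'I_n) :
  extreme_points (unit_ball (l1 R n)) x -> x 0 i != 0 -> x 0 j != 0 -> i = j.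
Proof.
rewrite /extreme_points /unit_ball /= => -[x1 ext] xi0 xj0.
apply/eqP/negPn/negP => ij.
have normE : `|x| = `|x 0 i| + \sum_(k | k != i) `|x 0 k|.
  by rewrite l1_normE (bigD1 i).
have jle : `|x 0 j| <= \sum_(k | k != i) `|x 0 k|.
  by rewrite (bigD1 j) 1?eq_sym//= lerDl sumr_ge0.
have xi_gt0 : 0 < `|x 0 i| by rewrite normr_gt0.
have xj_gt0 : 0 < `|x 0 j| by rewrite normr_gt0.
(* The weight of the convex combination is [|x_i|]; the positive mass at [j] keeps it below 1. *)
have t_lt1 : `|x 0 i| < 1 by lra.
pose y : l1 R n := \row_k (Num.sg (x 0 i) * (k == i)%:R).
pose z : l1 R n := \row_k (x 0 k * (k != i)%:R / (1 - `|x 0 i|)).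
have [||||yx _] := ext y z `|x 0 i|.
- rewrite l1_normE (bigD1 i)//= big1 => [|k ki]; rewrite mxE.
    by rewrite eqxx mulr1 addr0 normr_sg xi0.
  by rewrite (negPf ki) mulr0 normr0.
- rewrite l1_normE (bigD1 i)//= mxE eqxx mulr0 mul0r normr0 add0r.
  rewrite (eq_bigr (fun k => `|x 0 k| / (1 - `|x 0 i|))) => [|k ki].
    by rewrite -mulr_suml ler_pdivrMr; lra.
  rewrite mxE ki mulr1 normrM normfV [ `|1 - _| ]ger0_norm//; lra.
- by rewrite xi_gt0.
- apply/rowP => k; rewrite !mxE; have [->|ki] := eqVneq k i.
    by rewrite !(mulr0, mul0r) addr0 mulr1 mulrC -numEsg.
  by rewrite !mulr0 add0r mulr1; field; lra.
by move: xj0; rewrite -yx mxE [j == i]eq_sym (negPf ij) mulr0 eqxx.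
Qed.

Section RightSymmetric.
Variables (R : realType) (n : nat).
Implicit Types (x y : l1 R n) (A B : {set 'I_n}).

Definition disjoint_sums_differ x : Prop := forall A B,
  A != finset.set0 -> B != finset.set0 -> [disjoint A & B] ->
  A \subset (~: zero_coords x)%SET -> B \subset (~: zero_coords x)%SET ->
  `|\sum_(j in A) x 0 j| <> `|\sum_(j in B) x 0 j|.

(** Holds vacuously: the support has at most one index, which disjoint nonempty sets cannot
    share. *)
Lemma extreme_disjoint_sums_differ x :
  extreme_points (unit_ball (l1 R n)) x -> disjoint_sums_differ x.
Proof.
move=> ext A B /set0Pn[i iA] /set0Pn[j jB] dAB /fintype.subsetP Ax.
move=> /fintype.subsetP Bx _.
have /[!inE] xi := Ax _ iA; have /[!inE] xj := Bx _ jB.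
move: jB; rewrite -(extreme_point_support ext xi xj).
by rewrite (disjointFr dAB iA).
Qed.

Lemma disjoint_sums_differ_neq0 x A : disjoint_sums_differ x ->
  A != finset.set0 -> A \subset (~: zero_coords x)%SET ->
  \sum_(j in A) x 0 j != 0.
Proof.
move=> diff /set0Pn[i iA] Ax; have /[!inE] xi := fintype.subsetP Ax _ iA.
rewrite (big_setD1 i)//=; apply/eqP => /eqP.
have [->|Ai0] := eqVneq (A :\ i)%SET finset.set0.
  by rewrite big_set0 addr0 (negPf xi).
rewrite addr_eq0 => /eqP sumE.
apply: (diff [set i]%SET (A :\ i)%SET) => //.
- by apply/set0Pn; exists i; rewrite inE.
- by rewrite disjoints1 !inE eqxx.
- by rewrite finset.sub1set (fintype.subsetP Ax).
- by rewrite (fintype.subset_trans _ Ax)// finset.subD1set.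
- by rewrite big_set1 sumE normrN.
Qed.

Lemma disjoint_sums_differ_right_symmetric x :
  disjoint_sums_differ x -> rho_right_symmetric x.
Proof.
move=> diff y /rho_orthogonalP yx; apply/rho_orthogonalP.
pose A := [set i | (x 0 i != 0) && (0 < y 0 i)]%SET.
pose B := [set i | (x 0 i != 0) && (y 0 i < 0)]%SET.
have sAx : A \subset (~: zero_coords x)%SET.
  by apply/fintype.subsetP => i /[!inE] /andP[].
have sBx : B \subset (~: zero_coords x)%SET.
  by apply/fintype.subsetP => i /[!inE] /andP[].
have dAB : [disjoint A & B].
  rewrite -setI_eq0; apply/eqP/setP => i; rewrite !inE.
  by case: ltgtP; rewrite ?andbF.
(* Indices with [x_i = 0] contribute nothing to [yx], so [A] and [B] may be cut down to the support
   of [x]. *)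
have sumAB : \sum_(j in A) x 0 j = \sum_(j in B) x 0 j.
  apply: subr0_eq; rewrite big_mkcond [X in _ - X]big_mkcond -sumrB -[RHS]yx.
  apply: eq_bigr => i _; rewrite !inE.
  have [->|_] := eqVneq (x 0 i) 0; first by rewrite subrr mulr0.
  by case: (sgrP (y 0 i)) => /=; rewrite ?subr0 ?sub0r ?mul0r ?mul1r ?mulN1r.
(* Once both sets are empty, [y] vanishes on the support of [x], and every term of the goal is
   zero. *)
have AB0 : A = finset.set0 /\ B = finset.set0.
  have [A0|A0] := eqVneq A finset.set0; have [B0|B0] := eqVneq B finset.set0 => //.
  - have := disjoint_sums_differ_neq0 diff B0 sBx.
    by rewrite -sumAB A0 big_set0 eqxx.
  - have := disjoint_sums_differ_neq0 diff A0 sAx.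
    by rewrite sumAB B0 big_set0 eqxx.
  - by case: (diff A B A0 B0 dAB sAx sBx); rewrite sumAB.
rewrite big1// => i _; have [->|xi0] := eqVneq (x 0 i) 0.
  by rewrite sgr0 mul0r.
have := finset.in_set0 i; rewrite -{1}AB0.1 inE xi0.
have := finset.in_set0 i; rewrite -{1}AB0.2 inE xi0 /=.
by case: ltgtP => // ->; rewrite mulr0.
Qed.

Lemma right_symmetric_disjoint_sums_differ x :
  rho_right_symmetric x -> disjoint_sums_differ x.
Proof.
move=> sym A B /set0Pn[i iA] _ dAB /fintype.subsetP Ax _ /eqP.
rewrite eqr_norm2 => sumAB.
(* The relative sign [e], equal to 1 or -1, turns equal absolute values into a vanishing signed sum;
   the vector [y] below is then positive on [A] and has the sign of [e] on [B]. *)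
have {sumAB}[e e0 sumAB] : exists2 e : R,
    Num.sg e = e & \sum_(j in A) x 0 j + e * \sum_(j in B) x 0 j = 0.
  case/orP: sumAB => /eqP ->.
  - by exists (-1); rewrite ?sgrN1// mulN1r subrr.
  - by exists 1; rewrite ?sgr1// mul1r addNr.
pose s k : R := (k \in A)%:R + e * (k \in B)%:R.
(* Rescaling the coordinate [i] preserves the signs of [y], but changes
   [\sum_k sg (x_k) y_k]. *)
pose y (c : R) : l1 R n := \row_k (s k * (if k == i then c else 1)).
have orth (c : R) : 0 < c -> \sum_k Num.sg (x 0 k) * y c 0 k = 0.
  move=> c0; apply/rho_orthogonalP/sym/rho_orthogonalP.
  rewrite -[RHS]sumAB mulr_sumr [X in _ = X + _]big_mkcond.
  rewrite [X in _ = _ + X]big_mkcond -big_split /=.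
  apply: eq_bigr => k _; rewrite mxE sgrM.
  have -> : Num.sg (if k == i then c else 1) = 1 :> R.
    by case: ifP; rewrite ?sgr1 ?gtr0_sg.
  rewrite mulr1 /s; have [kA|kA] := boolP (k \in A).
    by rewrite (disjointFr dAB kA) mulr0 !addr0 sgr1 mul1r.
  by case: (k \in B); rewrite ?mulr1 ?mulr0 !add0r ?e0 ?sgr0 ?mul0r.
have /[!inE] xi := Ax _ iA.
(* Subtracting the relations for [c = 2] and [c = 1] leaves only the term at [i], namely
   [Num.sg (x 0 i)], which is nonzero. *)
have /eqP := etrans (orth 2 (ltr0Sn R 1)) (esym (orth 1 ltr01)).
rewrite -subr_eq0 -sumrB.
rewrite (bigD1 i)//= big1 ?addr0 => [|k ki]; last first.
  by rewrite !mxE (negPf ki) subrr.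
rewrite !mxE eqxx /s iA (disjointFr dAB iA) mulr0 addr0 !mul1r -mulrBr.
by rewrite mulf_eq0 sgr_eq0 (negPf xi) /=; lra.
Qed.

End RightSymmetric.

Theorem theorem3p13 (R : realType) (n : nat) (x : l1 R n)
    (hx : unit_sphere (l1 R n) x) :
  rho_right_symmetric x <->
  (extreme_points (unit_ball (l1 R n)) x \/
   (forall A B : {set 'I_n},
      A != finset.set0 -> B != finset.set0 -> [disjoint A & B] ->
      A \subset (~: zero_coords x)%SET -> B \subset (~: zero_coords x)%SET ->
      `|\sum_(j in A) x 0 j| <> `|\sum_(j in B) x 0 j|)).
Proof.
split=> [sym|[ext|diff]].
- by right; exact: right_symmetric_disjoint_sums_differ.
- exact/disjoint_sums_differ_right_symmetric/extreme_disjoint_sums_differ.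
- exact: disjoint_sums_differ_right_symmetric.
Qed.
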